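(* Let $n \geq 2$, let $A \cong \mathbb{Z}^n$ be the free abelian group (written additively) with free generators $x_1, x_2, \ldots, x_n$, and let $\psi \in \operatorname{Aut} A$ be the automorphism given by the cyclic permutation of the generators: $\psi(x_i) = x_{i+1}$ for $i = 1, \ldots, n-1$ and $\psi(x_n) = x_1$. Define $$a \circ b = a + \psi^{\sum_{i=1}^n \alpha_i}(b), \qquad a = \sum_{i=1}^n \alpha_i x_i,\ b \in A .$$ Then $(A, +, \circ)$ is a $\lambda$-cyclic brace. Moreover, $$(A, \circ) = \langle\, x, z \mid [x^{\circ n}, z] = 1,\ (z \circ x)^{\circ n} = x^{\circ n},\ [z, x^{\circ k}, z] = 1\ (1 \le k \le n-2) \,\rangle ,$$ where $x = x_1$ and $z = x_2 - x_1$.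
   Context: A (left) brace is a triple $(A, +, \circ)$ where $(A,+)$ is an abelian group, $(A,\circ)$ is a group, and $a \circ (b + c) = (a \circ b) - a + (a \circ c)$ for all $a,b,c \in A$. For $a \in A$ the map $\lambda_a : b \mapsto -a + (a \circ b)$ is an automorphism of $(A,+)$. The brace is $\lambda$-cyclic if $\lambda : (A,+) \to \operatorname{Aut}(A,+)$, $a \mapsto \lambda_a$, is a group homomorphism whose image is a cyclic subgroup of $\operatorname{Aut}(A,+)$. In the presentation, $\bar a$ denotes the inverse of $a$ in $(A,\circ)$, $a^{\circ k}$ denotes the $k$-th power of $a$ in $(A,\circ)$, $[a,b] = \bar a \circ \bar b \circ a \circ b$, and $[a,b,c] = [[a,b],c]$. *)

(* Defs.v *)
From HB Require Import structures.
From mathcomp Require Import all_boot all_order all_algebra.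
From mathcomp Require Import boolp classical_sets.

Set Implicit Arguments.
Unset Strict Implicit.
Unset Printing Implicit Defensive.

Import GRing.Theory.

Local Open Scope classical_set_scope.
Local Open Scope ring_scope.

Definition zexpg (G : groupType) (g : G) (m : int) : G :=
  match m with Posz k => (g ^+ k)%g | Negz k => (g ^- k.+1)%g end.

Definition free_basis (A : zmodType) (n : nat) (x : 'I_n -> A) : Prop :=
  forall a : A, exists! alpha : {ffun 'I_n -> int},
    a = \sum_(i < n) x i *~ alpha i.

(* The group Aut(A,+), with product (f * g) b = f (g b). *)
Section ZmodAut.
Variable A : zmodType.

Record zaut := ZAut {
  zaut_fun :> A -> A;
  zaut_inv : A -> A;
  zautD : {morph zaut_fun : a b / a + b};
  zautK : cancel zaut_fun zaut_inv;
  zautVK : cancel zaut_inv zaut_fun }.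

Lemma zautP (f g : zaut) : (forall a, f a = g a) -> f = g.
Proof.
case: f g => [f f' fD fK f'K] [g g' gD gK g'K] /= fg.
have {}fg : f = g by apply: funext.
subst g.
have fg' : f' = g' by apply: funext => a; apply: (can_inj fK); rewrite f'K g'K.
subst g'.
by congr ZAut; apply: Prop_irrelevance.
Qed.

Definition zaut_one : zaut := @ZAut id id (fun _ _ => erefl) (fun=> erefl) (fun=> erefl).

Lemma zaut_invD (f : zaut) : {morph zaut_inv f : a b / a + b}.
Proof. by move=> a b; apply: (can_inj (zautK f)); rewrite zautD !zautVK. Qed.

Definition zaut_inverse (f : zaut) : zaut :=
  ZAut (zaut_invD f) (zautVK f) (zautK f).

Lemma zaut_compD (f g : zaut) : {morph (fun a => f (g a)) : a b / a + b}.
Proof. by move=> a b; rewrite !zautD. Qed.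

Definition zaut_mul (f g : zaut) : zaut :=
  ZAut (zaut_compD f g) (can_comp (zautK f) (zautK g))
       (can_comp (zautVK g) (zautVK f)).

HB.instance Definition _ := gen_eqMixin zaut.
HB.instance Definition _ := gen_choiceMixin zaut.

Lemma zaut_mulA : associative zaut_mul.
Proof. by move=> f g h; apply: zautP. Qed.
Lemma zaut_mul1 : left_id zaut_one zaut_mul.
Proof. by move=> f; apply: zautP. Qed.
Lemma zaut_mulr1 : right_id zaut_one zaut_mul.
Proof. by move=> f; apply: zautP. Qed.
Lemma zaut_mulV : left_inverse zaut_one zaut_inverse zaut_mul.
Proof. by move=> f; apply: zautP => a /=; rewrite zautK. Qed.
Lemma zaut_mulrV : right_inverse zaut_one zaut_inverse zaut_mul.
Proof. by move=> f; apply: zautP => a /=; rewrite zautVK. Qed.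

HB.instance Definition _ :=
  isGroup.Build zaut zaut_mulA zaut_mul1 zaut_mulr1 zaut_mulV zaut_mulrV.

End ZmodAut.

Record brace (A : zmodType) := Brace {
  bop : A -> A -> A;
  bone : A;
  binv : A -> A;
  bopA : associative bop;
  bop1l : left_id bone bop;
  bop1r : right_id bone bop;
  binvl : left_inverse bone binv bop;
  binvr : right_inverse bone binv bop;
  bopD : forall a b c : A, bop a (b + c) = bop a b - a + bop a c }.

(* The carrier of A with the group structure given by the operation bop. *)
Definition circ_group (A : zmodType) (B : brace A) : Type := A.

HB.instance Definition _ (A : zmodType) (B : brace A) := Choice.on (circ_group B).
HB.instance Definition _ (A : zmodType) (B : brace A) :=
  isGroup.Build (circ_group B) (@bopA _ B) (@bop1l _ B) (@bop1r _ B)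
    (@binvl _ B) (@binvr _ B).

Section Lambda.
Variables (A : zmodType) (B : brace A).

Definition lambda_fun (a b : A) : A := - a + bop B a b.

(* Inverse of lambda_fun a. *)
Definition lambda_inv (a b : A) : A := bop B (binv B a) (a + b).

Lemma lambda_funD a : {morph lambda_fun a : b c / b + c}.
Proof. by move=> b c; rewrite /lambda_fun bopD !addrA. Qed.

Lemma lambda_funK a : cancel (lambda_fun a) (lambda_inv a).
Proof.
by move=> b; rewrite /lambda_inv /lambda_fun addrA subrr add0r bopA binvl bop1l.
Qed.

Lemma lambda_invK a : cancel (lambda_inv a) (lambda_fun a).
Proof.
by move=> b; rewrite /lambda_inv /lambda_fun bopA binvr bop1l addrA addNr add0r.
Qed.

Definition lambda (a : A) : zaut A :=
  ZAut (@lambda_funD a) (@lambda_funK a) (@lambda_invK a).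

Definition lambda_cyclic : Prop :=
  (forall a b : A, lambda (a + b) = (lambda a * lambda b)%g) /\
  exists phi : zaut A, range lambda = range (zexpg phi).

End Lambda.

(* The free group on X, as reduced words; the letter (x, false) stands for x
   and (x, true) for its inverse. *)
Section FreeGroup.
Variable X : choiceType.
Implicit Types (l : X * bool) (u v w : seq (X * bool)).

Definition linv l : X * bool := (l.1, ~~ l.2).

Definition reduced w : bool := sorted (fun l l' => l' != linv l) w.

Definition push l w : seq (X * bool) :=
  if w is l' :: w' then if l' == linv l then w' else l :: w else [:: l].

Definition wmul u v : seq (X * bool) := foldr push v u.

Definition winv w : seq (X * bool) := rev (map linv w).

Lemma linvK : involutive linv.
Proof. by case=> x b; rewrite /linv /= negbK. Qed.

Lemma push_reduced l w : reduced w -> reduced (push l w).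
Proof.
case: w => [|l' w] //=; case: ifP => [_ /path_sorted //|/negbT ne pw].
by rewrite /reduced /= ne.
Qed.

Lemma pushK l w : reduced w -> push (linv l) (push l w) = w.
Proof.
case: w => [|l' w] /=; first by rewrite linvK eqxx.
case: eqP => [->|_] /=; last by rewrite linvK eqxx.
case: w => [|l2 w] //=.
by rewrite /reduced /= linvK => /andP[/negbTE ->].
Qed.

Lemma wmul_reduced u v : reduced v -> reduced (wmul u v).
Proof. by move=> rv; elim: u => //= l u; apply: push_reduced. Qed.

Lemma wmul_push l u v : reduced v -> wmul (push l u) v = push l (wmul u v).
Proof.
move=> rv; case: u => [|l' u] //=; case: eqP => [->|_] //=.
by rewrite -[LHS](pushK (linv l)) ?linvK ?wmul_reduced.
Qed.

Lemma wmulA u v w : reduced w -> wmul u (wmul v w) = wmul (wmul u v) w.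
Proof. by move=> rw; elim: u => //= l u ->; rewrite wmul_push. Qed.

Lemma wmulw1 u : reduced u -> wmul u [::] = u.
Proof.
elim: u => //= l u IH ru; rewrite (IH (path_sorted ru)).
by case: u ru {IH} => //= l' u /andP[/negbTE ->].
Qed.

Lemma winv_reduced u : reduced u -> reduced (winv u).
Proof.
rewrite /reduced /winv rev_sorted sorted_map; apply: sub_sorted => l l' /=.
by rewrite linvK; apply: contraNneq => <-; rewrite ?linvK.
Qed.

Lemma winvK : involutive winv.
Proof. by move=> u; rewrite /winv map_rev revK mapK //; apply: linvK. Qed.

Lemma wmulVK u v : reduced v -> wmul (winv u) (wmul u v) = v.
Proof.
elim: u v => //= l u IH v rv; rewrite /winv /= rev_cons -cats1 /wmul foldr_cat /=.
by rewrite -/(wmul u v) pushK ?wmul_reduced // [LHS]IH.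
Qed.

Record free_group := FreeGroup {
  fword :> seq (X * bool);
  fword_reduced : reduced fword }.

HB.instance Definition _ := [isSub for fword].
HB.instance Definition _ := [Choice of free_group by <:].

Definition free_mul (u v : free_group) : free_group :=
  FreeGroup (wmul_reduced u (fword_reduced v)).
Definition free_one : free_group := @FreeGroup [::] isT.
Definition free_inv (u : free_group) : free_group :=
  FreeGroup (winv_reduced (fword_reduced u)).

Lemma fmulA : associative free_mul.
Proof. by move=> u v w; apply/val_inj/wmulA/fword_reduced. Qed.
Lemma fmul1 : left_id free_one free_mul.
Proof. by move=> u; apply/val_inj. Qed.
Lemma fmulr1 : right_id free_one free_mul.
Proof. by move=> u; apply/val_inj/wmulw1/fword_reduced. Qed.
Lemma fmulV : left_inverse free_one free_inv free_mul.
Proof.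
move=> u; apply/val_inj => /=.
by rewrite -{2}[fword u]wmulw1 ?wmulVK ?fword_reduced.
Qed.
Lemma fmulrV : right_inverse free_one free_inv free_mul.
Proof.
move=> u; apply/val_inj => /=.
by rewrite -{1}[fword u]winvK -{2}[winv u]wmulw1 ?wmulVK // winv_reduced ?fword_reduced.
Qed.

HB.instance Definition _ :=
  isGroup.Build free_group fmulA fmul1 fmulr1 fmulV fmulrV.

Definition fgen (x : X) : free_group := @FreeGroup [:: (x, false)] isT.

Variable G : groupType.
Variable gen : X -> G.

Definition eval_letter l : G := if l.2 then (gen l.1)^-1%g else gen l.1.

(* The homomorphism free_group -> G extending gen. *)
Definition free_lift (w : free_group) : G := (\prod_(l <- fword w) eval_letter l)%g.

Lemma free_lift_gen x : free_lift (fgen x) = gen x.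
Proof. by rewrite /free_lift /= big_seq1. Qed.

Lemma free_liftM (u v : free_group) :
  free_lift (u * v)%g = (free_lift u * free_lift v)%g.
Proof.
rewrite /free_lift /=; elim: (fword u) => [|l w IH] /=.
  by rewrite big_nil mul1g.
rewrite big_cons -mulgA -IH; case: (wmul w _) => [|l' w'] /=; first by rewrite !big_cons.
case: eqP => [->|_]; last by rewrite big_cons.
by rewrite big_cons /eval_letter /=; case: l.2; rewrite ?mulKg ?mulVKg.
Qed.

End FreeGroup.

Definition normal_subgroup (G : groupType) (N : set G) : Prop :=
  [/\ N 1%g, forall g h : G, N g -> N h -> N (g * h)%g,
      forall g : G, N g -> N (g^-1)%g & forall g h : G, N g -> N (g ^ h)%g].

(* G = < gen | u = v for (u, v) in rels >: the homomorphism from the free group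
   on X to G is surjective, with kernel the normal closure of the elements
   u v^-1. *)
Definition presentation (X : choiceType) (G : groupType) (gen : X -> G)
    (rels : set (free_group X * free_group X)) : Prop :=
  range (free_lift gen) = [set: G] /\
  [set w | free_lift gen w = 1%g] =
    smallest (@normal_subgroup (free_group X))
      [set (r.1 * r.2^-1)%g | r in rels].

(* The free generators playing the role of x and z. *)
Definition fx := fgen false.
Definition fz := fgen true.

Definition gen_xz (G : Type) (x z : G) (b : bool) : G := if b then z else x.

Definition cyclic_relations (n : nat) :=
  [set ([~ fx ^+ n, fz], 1)%g; ((fz * fx) ^+ n, fx ^+ n)%g] `|`
  [set ([~ fz, fx ^+ k, fz], 1)%g | k in [set k : nat | 1 <= k <= n - 2]%N].

(* Main.v *)
(* Write z_i for the conjugate of z by x^-i.  In any group satisfying the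
   relations z_i only depends on i mod n, the z_i commute, and, as
   (z x)^n = z_0 ... z_(n-1) x^n, their product is 1; hence every word takes the
   form z_0^(c_0) ... z_(n-1)^(c_(n-1)) x^m.  In (A, o) the coordinate sum is a
   homomorphism to Z whose kernel carries the same operation as (A, +), and z_i
   is x_(i+2) - x_(i+1), with cyclic indices.  So such a form is trivial in
   (A, o) only if m = 0 and c is constant, in which case it is trivial in every
   group satisfying the relations. *)
Require Import Defs.
From HB Require Import structures.
From mathcomp Require Import all_boot all_order all_algebra.
From mathcomp Require Import boolp classical_sets.
From mathcomp Require Import zify.

Set Implicit Arguments.
Unset Strict Implicit.
Unset Printing Implicit Defensive.

Import GRing.Theory.

Local Open Scope ring_scope.

(** With an equivalence as step, one argument both climbs and descends, so negative exponents need
    no separate case. *)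
Lemma int_stepW (P : int -> Prop) :
  P 0 -> (forall m, P m <-> P (m + 1)) -> forall m, P m.
Proof.
move=> P0 PS; elim/int_ind => // k IH.
  by rewrite (_ : k.+1%:Z = k%:Z + 1); [apply: (PS _).1 | lia].
by apply: (PS _).2; rewrite (_ : - k.+1%:Z + 1 = - k%:Z); [|lia].
Qed.

(** * Integer powers in a group *)

Section IntPowers.
Variable G : groupType.
Implicit Types g h : G.

Lemma zexpgD1 g m : zexpg g (m + 1) = (zexpg g m * g)%g.
Proof.
case: m => [k|k]; first by rewrite /= addn1 expgSr.
case: k => [|k]; first by rewrite /= expg1 mulVg.
have -> : Negz k.+1 + 1 = Negz k by lia.
by rewrite /= [(g ^+ k.+2)%g]expgS invgM mulgVK.
Qed.

Lemma zexpgD g m k : zexpg g (m + k) = (zexpg g m * zexpg g k)%g.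
Proof.
elim/int_stepW: k => [|k]; first by rewrite addr0 /= mulg1.
by rewrite addrA !zexpgD1 mulgA; split=> [->|/mulIg].
Qed.

Lemma zexpgJ g h m : zexpg (g ^ h)%g m = (zexpg g m ^ h)%g.
Proof. by case: m => k /=; rewrite ?conjVg conjXg. Qed.

Lemma commute_zexpg g h m : commute g h -> commute g (zexpg h m).
Proof. by move=> gh; case: m => k /=; try apply: commuteV; apply: commuteX. Qed.

Lemma commuteJ g h k : commute g h -> commute (g ^ k)%g (h ^ k)%g.
Proof. by rewrite /commute -!conjMg => ->. Qed.

End IntPowers.

Lemma gmulf_zexpg (G H : groupType) (f : UMagmaMorphism.type G H) (g : G) m :
  f (zexpg g m) = zexpg (f g) m.
Proof. by case: m => k /=; rewrite ?gmulfV gmulfXn. Qed.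

(** * Normal forms of words under the cyclic relations *)

Section NormalForm.
Variable n : nat.

(* The exponents [c i], [i < n], are redundant: the relations make the product
   of the [n] conjugates trivial. *)
Definition zprod (G : groupType) (x z : G) (c : nat -> int) : G :=
  (\prod_(i < n) zexpg (z ^ (x ^- i)) (c i))%g.

(** Exponents after conjugation by [x^-1], which moves the [i]-th conjugate to place [i + 1] modulo
    [n]. *)
Definition cshift (c : nat -> int) (i : nat) : int :=
  if i is j.+1 then c j else c n.-1.

Lemma gmulf_zprod (G H : groupType) (f : UMagmaMorphism.type G H) (x z : G) c :
  f (zprod x z c) = zprod (f x) (f z) c.
Proof.
rewrite gmulf_prod; apply: eq_bigr => i _.
by rewrite gmulf_zexpg gmulfJ gmulfV gmulfXn.
Qed.

Lemma zprod_ext (G : groupType) (x z : G) c d :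
  (forall i, (i < n)%N -> c i = d i) -> zprod x z c = zprod x z d.
Proof. by move=> cd; apply: eq_bigr => i _; rewrite cd. Qed.

(** Each new [z] passes to the left of [x ^+ k] at the cost of a conjugation by [x ^- k]. *)
Lemma expg_zx (G : groupType) (x z : G) k :
  ((z * x) ^+ k = (\prod_(i < k) z ^ (x ^- i)) * x ^+ k)%g.
Proof.
elim: k => [|k IH]; first by rewrite big_ord0 mul1g.
by rewrite expgSr IH big_ord_recr /= conjgE invgK expgSr !mulgA mulgVK.
Qed.

(** Inverse of [cshift] on the indices below [n]; it describes conjugation by [x]. *)
Definition cunshift (c : nat -> int) (i : nat) : int :=
  if i == n.-1 then c 0%N else c i.+1.

(** The relations as equations in an arbitrary group; [cyclic_relsP] links them to the pairs of free
    words. *)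
Definition cyclic_rels (G : groupType) (x z : G) : Prop :=
  [/\ [~ x ^+ n, z] = 1, (z * x) ^+ n = x ^+ n
    & forall k, (1 <= k <= n - 2)%N -> [~ z, x ^+ k, z] = 1]%g.

Hypothesis n_gt1 : (1 < n)%N.

Section Relations.
Variables (G : groupType) (x z : G).
Hypothesis relsG : cyclic_rels x z.

Let t i : G := (z ^ (x ^- i))%g.

Lemma conjX_J i j : (t i ^ (x ^- j))%g = t (i + j).
Proof. by rewrite /t -conjgM -invgM -expgnDr addnC. Qed.

(** The first relation makes [x ^+ n] commute with [z], so [n] further conjugations change
    nothing. *)
Lemma conjX_mod i : t i = t (i %% n)%N.
Proof.
have tn j : t (n + j) = t j.
  case: relsG => rel _ _.
  rewrite -conjX_J; congr (_ ^ _)%g; rewrite /t conjgE invgK.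
  by apply/eqP; rewrite mulgA divg_eq; exact/eqP/commgP/eqP.
rewrite {1}(divn_eq i n); elim: (i %/ n)%N => //= q IH.
by rewrite mulSn -addnA tn.
Qed.

Lemma prod_conjX : (\prod_(i < n) t i)%g = 1%g.
Proof.
by case: relsG => _ rel _; apply: (mulIg (x ^+ n)%g); rewrite -expg_zx mul1g.
Qed.

(** The residue [r] of [d] modulo [n] decides: the commutator relations cover [1 <= r <= n - 2], and
    for [n > 2] the case [r = n - 1] follows from [r = 1] by conjugating with [x ^- n.-1]. *)
Lemma commute_conjX0 d : commute z (t d).
Proof.
have t0 : t 0 = z by rewrite /t invg1 conjg1.
have low k : (1 <= k <= n - 2)%N -> commute z (t k).
  (* As [[z, x^k] = z^-1 z^(x^k)], the relation makes [z] commute with [z^(x^k)]; conjugating by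
     [x^-k] then gives [t k]. *)
  case: relsG => _ _ rel /rel/eqP/commgP zk.
  have {}zk : commute z (z ^ (x ^+ k))%g.
    rewrite -[(z ^ _)%g](mulVKg z) -commgEl.
    by apply: commuteM; [exact: commute_refl | exact: commute_sym].
  by have := commuteJ (x ^- k)%g zk; rewrite conjgK => /commute_sym.
rewrite conjX_mod; have : (d %% n < n)%N by rewrite ltn_mod ltnW.
move: (d %% n)%N => r r_lt.
have [->|r_gt0] := posnP r; first by rewrite t0.
have [r_le|r_ge] := leqP r (n - 2); first by apply: low; rewrite r_gt0.
have -> : r = n.-1 by lia.
(* For [n = 2] the range of the commutator relations is empty; the product relation reads
   [t 0 * t 1 = 1], so [t 1] is the inverse of [z]. *)
have [n2|n_neq2] := eqVneq n 2%N.
  have := prod_conjX; rewrite /t n2 big_ord_recr big_ord1 /=.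
  rewrite -/(t 0) t0 -/(t 1) => tz.
  by rewrite -(mulg1_eq tz); apply: commuteV.
have /(commuteJ (x ^- n.-1)%g) : commute z (t 1) by apply: low; lia.
rewrite -/(t n.-1) conjX_J add1n (ltn_predK n_gt1) (conjX_mod n) modnn t0.
exact: commute_sym.
Qed.

Lemma commute_conjX i j : commute (t i) (t j).
Proof.
wlog ij : i j / (i <= j)%N.
  by move=> H; have [/H //|/ltnW/H/commute_sym] := leqP i j.
by rewrite -(subnK ij) -conjX_J; apply: commuteJ; apply: commute_conjX0.
Qed.

Lemma commute_zexpg_conjX i j a b : commute (zexpg (t i) a) (zexpg (t j) b).
Proof. by apply/commute_zexpg/commute_sym/commute_zexpg/commute_conjX. Qed.

Lemma zprodD c d :
  zprod x z (fun i => c i + d i) = (zprod x z c * zprod x z d)%g.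
Proof.
rewrite -prodgM_commute => [|i j _ _]; last exact: commute_zexpg_conjX.
by apply: eq_bigr => i _; rewrite zexpgD.
Qed.

(** Raising all exponents by one multiplies by the product of all the conjugates, which is
    trivial. *)
Lemma zprod_const a : zprod x z (fun=> a) = 1%g.
Proof.
have step b : zprod x z (fun=> b + 1) = zprod x z (fun=> b).
  rewrite zprodD [X in (_ * X)%g](_ : _ = 1%g) ?mulg1 //.
  by rewrite -[RHS]prod_conjX; apply: eq_bigr => i _ /=; rewrite expg1.
by elim/int_stepW: a => [|b]; [apply: big1 => i _ | rewrite step].
Qed.

Lemma zprod_delta a : zprod x z (fun i => if i == 0%N then a else 0) = zexpg z a.
Proof.
rewrite /zprod -(ltn_predK n_gt1) big_ord_recl /= invg1 conjg1.
by rewrite big1 ?mulg1.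
Qed.

(** The last factor becomes a power of [t n = t 0] and has to return to the front, which commutation
    allows. *)
Lemma zprod_shift c : (zprod x z c ^ x^-1)%g = zprod x z (cshift c).
Proof.
rewrite conjg_prod.
rewrite (eq_bigr (fun i : 'I__ => zexpg (t i.+1) (c i))) => [|i _]; last first.
  by rewrite -zexpgJ -{2}[x]expg1 conjX_J addn1.
have nE := ltn_predK n_gt1.
have rot : (\prod_(i < n.-1.+1) zexpg (t i.+1) (c i)
            = \prod_(i < n.-1.+1) zexpg (t i) (cshift c i))%g.
  rewrite big_ord_recr big_ord_recl /= nE (conjX_mod n) modnn.
  apply: commute_sym; apply: commute_prod => i _; exact: commute_zexpg_conjX.
by move: rot; rewrite nE.
Qed.

Lemma zprod_unshift c : (zprod x z c ^ x)%g = zprod x z (cunshift c).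
Proof.
apply: (@conjg_inj _ x^-1)%g.
rewrite -conjgM mulgV conjg1 zprod_shift; apply: zprod_ext => -[|i] i_lt /=.
  by rewrite /cunshift eqxx.
rewrite /cunshift; case: eqP => // i_eq.
by move: i_lt; rewrite i_eq prednK ?ltnn ?(ltnW n_gt1).
Qed.

End Relations.

(* The exponents depend on the word only, not on the group: this is what allows
   a relation between words to be transported from one group to another. *)
Lemma word_normal_form (w : seq (bool * bool)) :
  exists c m, forall (G : groupType) (x z : G), cyclic_rels x z ->
    (\prod_(l <- w) eval_letter (gen_xz x z) l)%g
    = (zprod x z c * zexpg x m)%g.
Proof.
elim: w => [|l w [c [m IH]]].
  by exists (fun=> 0), 0 => G x z rels; rewrite big_nil zprod_const // mulg1.
(* A letter [z] or its inverse alters only the exponent at index 0; a letter [x] or its inverse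
   passes through the product by shifting the exponents. *)
have delta (e : int) : exists c' m', forall (G : groupType) (x z : G),
    cyclic_rels x z ->
    (zexpg z e * \prod_(l <- w) eval_letter (gen_xz x z) l
     = zprod x z c' * zexpg x m')%g.
  exists (fun i => (if i == 0%N then e else 0) + c i), m => G x z rels.
  by rewrite (IH _ _ _ rels) zprodD // zprod_delta -mulgA.
case: l => -[] [].
- have [c' [m' E]] := delta (- 1); exists c', m' => G x z rels.
  by rewrite big_cons -E.
- have [c' [m' E]] := delta 1; exists c', m' => G x z rels.
  by rewrite big_cons -E.
- exists (cunshift c), (- 1 + m) => G x z rels; rewrite big_cons (IH _ _ _ rels).
  by rewrite -zprod_unshift // zexpgD conjgE -!mulgA /= expg1 mulVKg.
- exists (cshift c), (1 + m) => G x z rels; rewrite big_cons (IH _ _ _ rels).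
  by rewrite -zprod_shift // zexpgD conjgE invgK -!mulgA /= expg1 mulKg.
Qed.

End NormalForm.

(** * Quotient of a group by a normal subgroup *)

Section QuotientGroup.
Variables (G : groupType) (N : set G).
Hypothesis normN : normal_subgroup N.

Definition ncong : rel G := fun g h => `[< N (g * h^-1)%g >].

Lemma ncong_refl : reflexive ncong.
Proof. by case: normN => N1 _ _ _ g; apply/asboolP; rewrite mulgV. Qed.

Lemma ncong_sym : symmetric ncong.
Proof.
case: normN => _ _ NV _; suff S g h : ncong g h -> ncong h g.
  by move=> g h; apply/idP/idP; apply: S.
by move=> /asboolP/NV; rewrite invgF => ?; apply/asboolP.
Qed.

Lemma ncong_trans : transitive ncong.
Proof.
case: normN => _ NM _ _ h g k /asboolP gh /asboolP hk; apply/asboolP.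
by rewrite -(divgKA h); apply: NM.
Qed.

Canonical ncong_equiv := EquivRel ncong ncong_refl ncong_sym ncong_trans.

Definition quotg := {eq_quot ncong}%qT.
HB.instance Definition _ := Choice.on quotg.

Definition piq (g : G) : quotg := (\pi_quotg g)%qT.
Definition mulq (a b : quotg) : quotg := piq (repr a * repr b)%g.
Definition invq (a : quotg) : quotg := piq (repr a)^-1%g.

Lemma piq_eq g h : (piq g = piq h) <-> N (g * h^-1)%g.
Proof. by split=> [/eqmodP/asboolP|?] //; apply/eqmodP/asboolP. Qed.

Lemma repr_piq g : N (repr (piq g) * g^-1)%g.
Proof. by apply/piq_eq; rewrite /piq reprK. Qed.

(** Passing to representatives multiplies [g] and [h] on the left by elements of [N]; normality
    carries the second of these across [g]. *)
Lemma piqM g h : piq (g * h)%g = mulq (piq g) (piq h).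
Proof.
case: normN => _ NM _ NJ; apply/esym/piq_eq.
rewrite [X in N X]
  (_ : _ = (repr (piq g) * g^-1) * (repr (piq h) * h^-1) ^ g^-1)%g.
  by apply: NM; [|apply: NJ]; apply: repr_piq.
by rewrite conjgE invgK invgM !mulgA mulgVK.
Qed.

Lemma piqV g : piq g^-1%g = invq (piq g).
Proof.
case: normN => _ _ NV NJ; apply/esym/piq_eq.
rewrite [X in N X](_ : _ = ((repr (piq g) * g^-1) ^ g)^-1)%g.
  by apply/NV/NJ/repr_piq.
by rewrite conjgE mulgVK invgM !invgK.
Qed.

Lemma piqW (P : quotg -> Prop) : (forall g, P (piq g)) -> forall a, P a.
Proof. by move=> H a; rewrite -[a]reprK; apply: H. Qed.

Lemma mulqA : associative mulq.
Proof.
by elim/piqW=> a; elim/piqW=> b; elim/piqW=> c; rewrite -!piqM mulgA.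
Qed.
Lemma mul1q : left_id (piq 1%g) mulq.
Proof. by elim/piqW=> a; rewrite -piqM mul1g. Qed.
Lemma mulq1 : right_id (piq 1%g) mulq.
Proof. by elim/piqW=> a; rewrite -piqM mulg1. Qed.
Lemma mulVq : left_inverse (piq 1%g) invq mulq.
Proof. by elim/piqW=> a; rewrite -piqV -piqM mulVg. Qed.
Lemma mulqV : right_inverse (piq 1%g) invq mulq.
Proof. by elim/piqW=> a; rewrite -piqV -piqM mulgV. Qed.

HB.instance Definition _ := isGroup.Build quotg mulqA mul1q mulq1 mulVq mulqV.

Lemma piqF : {morph piq : g h / (g / h)%g}.
Proof. by move=> g h; rewrite piqM piqV. Qed.
HB.instance Definition _ := isGroupMorphism.Build G quotg piq piqF.

Lemma piq_eq1 g : (piq g = 1%g) <-> N g.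
Proof. by rewrite -{2}[g]divg1; exact: piq_eq. Qed.

End QuotientGroup.

(** * Free groups and a criterion for presentations *)

Section Presentations.
Variables (X : choiceType).

Lemma free_liftF (G : groupType) (gen : X -> G) :
  {morph free_lift gen : u v / (u / v)%g}.
Proof.
move=> u v; apply/esym/eqP; rewrite divg_eq; apply/eqP.
by rewrite -free_liftM mulgVK.
Qed.
HB.instance Definition _ (G : groupType) (gen : X -> G) :=
  isGroupMorphism.Build (free_group X) G (free_lift gen) (free_liftF gen).

Lemma free_word_prod (w : free_group X) :
  w = (\prod_(l <- fword w) eval_letter (@fgen X) l)%g.
Proof.
case: w => w; elim: w => [|l w IH] rw; first by rewrite big_nil; apply/val_inj.
rewrite big_cons -(IH (path_sorted rw)); apply/val_inj => /=.
rewrite /eval_letter; case: l rw => a [] /=; case: w {IH} => //= l' w;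
  by move=> /andP[/negbTE ->].
Qed.

Lemma free_lift_unique (G : groupType) (gen : X -> G)
    (f : UMagmaMorphism.type (free_group X) G) :
  (forall a, f (fgen a) = gen a) -> f =1 free_lift gen.
Proof.
move=> fgenE w; rewrite {1}[w]free_word_prod gmulf_prod.
by apply: eq_bigr => -[a []] _; rewrite /eval_letter /= ?gmulfV fgenE.
Qed.

(** The kernel condition becomes a test in all groups satisfying the relations. Testing in the
    quotient of the free group by a normal [N] containing the relators puts the kernel inside [N];
    conversely, the kernel is itself such an [N]. *)
Lemma presentationP (G : groupType) (gen : X -> G)
    (rels : set (free_group X * free_group X)) :
  (forall g, exists w, free_lift gen w = g) ->
  (forall r, rels r -> free_lift gen r.1 = free_lift gen r.2) ->
  (forall (Q : groupType) (gen' : X -> Q),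
     (forall r, rels r -> free_lift gen' r.1 = free_lift gen' r.2) ->
     forall w, free_lift gen w = 1%g -> free_lift gen' w = 1%g) ->
  presentation gen rels.
Proof.
move=> surj relsG univ; split.
  by apply/seteqP; split=> // g _; have [w <-] := surj g; exists w.
apply/seteqP; split=> [w /= w1 N [normN relsN]|w].
  have piqE := free_lift_unique (f := piq normN) (fun=> erefl).
  apply/(piq_eq1 normN); rewrite piqE; apply: univ w w1 => r rr; rewrite -!piqE.
  by apply/piq_eq/relsN; exists r.
apply; split=> [|_ [r /relsG rE <-]] /=; last by rewrite gmulfF /= rE mulgV.
split=> [|u v /= u1 v1|u /= u1|u v /= u1].
- exact: gmulf1.
- by rewrite gmulfM /= u1 v1 mulg1.
- by rewrite gmulfV /= u1 invg1.
- by rewrite gmulfJ /= u1 conj1g.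
Qed.

End Presentations.

(** * Additive automorphisms and coordinates in a free basis *)

Section ZautAdditive.
Variables (A : zmodType) (f : zaut A).

Lemma zautB : {morph f : a b / a - b}.
Proof.
by move=> a b; apply/eqP; rewrite eq_sym subr_eq -zautD addrNK.
Qed.

HB.instance Definition _ := GRing.isZmodMorphism.Build A A f zautB.

End ZautAdditive.

Section FreeBasis.
Variables (A : zmodType) (n : nat) (x : 'I_n -> A).
Hypothesis hx : free_basis x.

Lemma free_basis_inj (c d : 'I_n -> int) :
  \sum_(i < n) x i *~ c i = \sum_(i < n) x i *~ d i -> c =1 d.
Proof.
move=> cd; have [e [_ uniq_e]] := hx (\sum_(i < n) x i *~ c i).
have E (f : 'I_n -> int) :
    \sum_(i < n) x i *~ c i = \sum_(i < n) x i *~ f i -> e = [ffun i => f i].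
  by move=> cf; apply: uniq_e; rewrite cf; apply: eq_bigr => i _; rewrite ffunE.
by move=> i; have := congr1 (fun h : {ffun _} => h i) (E c erefl);
   rewrite (E d cd) !ffunE => ->.
Qed.

(** Coordinates come from choice, and their uniqueness makes the sum additive. This degree is the
    exponent of [psi] in the circle operation. *)
Lemma free_basis_degree : exists s : {additive A -> int},
  forall c : 'I_n -> int, s (\sum_(i < n) x i *~ c i) = \sum_(i < n) c i.
Proof.
have /choice [c cE] a : exists c : {ffun 'I_n -> int},
    a = \sum_(i < n) x i *~ c i.
  by have [c [cE _]] := hx a; exists c.
pose s a := \sum_(i < n) c a i.
have sB : {morph s : a b / a - b}.
  move=> a b; rewrite /s -sumrB; apply: eq_bigr => i _.
  apply: (free_basis_inj (d := fun i => c a i - c b i)).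
  by rewrite -cE (eq_bigr _ (fun i _ => mulrzBr _ _ _)) sumrB -!cE.
pose sM := GRing.isZmodMorphism.Build _ _ s sB.
pose s' : {additive A -> int} := HB.pack s sM.
exists s' => d; apply: eq_bigr => i _.
by apply: (free_basis_inj (c := c _)); rewrite -cE.
Qed.

End FreeBasis.

(** * The brace given by an automorphism and an invariant degree *)

Section CyclicBrace.
Variables (A : zmodType) (psi : zaut A) (s : {additive A -> int}).
Hypothesis s_psi : forall a, s (psi a) = s a.

Let P (m : int) : zaut A := zexpg psi m.

Lemma zexpg_appD m k a : P (m + k) a = P m (P k a).
Proof. by rewrite /P zexpgD. Qed.

Lemma s_zexpg m a : s (P m a) = s a.
Proof.
have s1 (k : int) b : s (P (k + 1) b) = s (P k b).
  by rewrite addrC zexpg_appD s_psi.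
by elim/int_stepW: m => // k; rewrite s1.
Qed.

Definition cyc_op (a b : A) : A := a + P (s a) b.
Definition cyc_inv (a : A) : A := - P (- s a) a.

(** Invariance under [psi] makes the degree a homomorphism for the circle operation too;
    associativity rests on this. *)
Lemma s_cyc_op a b : s (cyc_op a b) = s a + s b.
Proof. by rewrite raddfD s_zexpg. Qed.

Lemma cyc_opA : associative cyc_op.
Proof.
by move=> a b c; rewrite {1 3}/cyc_op s_cyc_op zexpg_appD zautD addrA.
Qed.
Lemma cyc_op0 : right_id 0 cyc_op.
Proof. by move=> a; rewrite /cyc_op -(subrr 0) zautD raddfN subrr addr0. Qed.
Lemma cyc_0op : left_id 0 cyc_op.
Proof. by move=> a; rewrite /cyc_op raddf0 add0r. Qed.
Lemma cyc_opN : right_inverse 0 cyc_inv cyc_op.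
Proof.
by move=> a; rewrite /cyc_op /cyc_inv raddfN /= -zexpg_appD subrr /= subrr.
Qed.
Lemma cyc_Nop : left_inverse 0 cyc_inv cyc_op.
Proof. by move=> a; rewrite /cyc_op /cyc_inv raddfN s_zexpg addNr. Qed.
Lemma cyc_opD a b c : cyc_op a (b + c) = cyc_op a b - a + cyc_op a c.
Proof. by rewrite /cyc_op zautD !addrA addrNK. Qed.

Definition cyc_brace : brace A :=
  Brace cyc_opA cyc_0op cyc_op0 cyc_Nop cyc_opN cyc_opD.

Lemma lambda_cyc a : lambda cyc_brace a = P (s a).
Proof. by apply: zautP => b; rewrite /= /lambda_fun addKr. Qed.

(** Since [s] takes the value 1, it takes every integer value, so every power of [psi] is some
    [lambda a]. *)
Lemma cyc_brace_lambda_cyclic x : s x = 1 -> lambda_cyclic cyc_brace.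
Proof.
move=> sx; split=> [a b|]; first by rewrite !lambda_cyc raddfD /P zexpgD.
exists psi; apply/seteqP; split=> _ [m _ <-] /=.
  by exists (s m) => //; rewrite lambda_cyc.
by exists (x *~ m) => //; rewrite lambda_cyc raddfMz sx /P mulrzz mul1r.
Qed.

Let G := circ_group cyc_brace.
Implicit Types g h : G.

Definition deg (g : G) : int := s g.

Lemma degM g h : deg (g * h)%g = deg g + deg h.
Proof. exact: s_cyc_op. Qed.
Lemma deg1 : deg 1%g = 0.
Proof. exact: raddf0. Qed.
Lemma degV g : deg g^-1%g = - deg g.
Proof. by apply: (addrI (deg g)); rewrite -degM mulgV deg1 subrr. Qed.
Lemma degJ g h : deg (g ^ h)%g = deg g.
Proof. by rewrite conjgE !degM degV addrC addrK. Qed.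
Lemma deg_zexpg g m : deg (zexpg g m) = deg g * m.
Proof.
have step (k : int) : deg (zexpg g (k + 1)) = deg (zexpg g k) + deg g.
  by rewrite zexpgD1 degM.
elim/int_stepW: m => [|k]; first by rewrite mulr0 deg1.
by rewrite step mulrDr mulr1; split=> [->|/addIr].
Qed.

Lemma deg_zprod n x z c : deg z = 0 -> deg (zprod n x z c) = 0.
Proof.
move=> z0; rewrite /zprod (big_morph deg degM deg1) big1 // => i _.
by rewrite deg_zexpg degJ z0 mul0r.
Qed.

Lemma mulg_deg0 g h : deg g = 0 -> (g * h)%g = (g : A) + (h : A).
Proof. by move=> g0; rewrite -[LHS]/(g + P (deg g) h) g0. Qed.

Lemma commute_deg0 g h : deg g = 0 -> deg h = 0 -> commute g h.
Proof. by move=> g0 h0; rewrite /commute !mulg_deg0 // addrC. Qed.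

(** For [h] of degree 0, the circle product of [x] and [h] is [x + psi h = psi h + x], that is, the
    circle product of [psi h] and [x]. Hence conjugation by [x^-1] acts as [psi]. *)
Lemma conjg_deg1 x g k :
  deg x = 1 -> deg g = 0 -> (g ^ (x ^- k))%g = iter k psi g.
Proof.
move=> x1 g0; elim: k => [|k IH]; first by rewrite invg1 conjg1.
rewrite expgS invgM conjgM IH iterS; set h := iter k psi g.
have h0 : deg h = 0 by rewrite /h -IH degJ.
rewrite conjgE invgK; apply/eqP; rewrite mulgA divg_eq; apply/eqP.
rewrite (@mulg_deg0 (psi h)); last by rewrite /deg s_psi.
by rewrite -[LHS]/(x + P (deg x) h) x1 addrC.
Qed.

Lemma zexpg_deg0 g m : deg g = 0 -> zexpg g m = (g : A) *~ m.
Proof.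
move=> g0; have step (k : int) : zexpg g (k + 1) = (zexpg g k : A) + (g : A).
  by rewrite zexpgD1 mulg_deg0 // deg_zexpg g0 mul0r.
elim/int_stepW: m => [|k]; first by rewrite mulr0z.
by rewrite step mulrzDr mulr1z; split=> [->|/addIr].
Qed.

Lemma prodg_deg0 I (r : seq I) (F : I -> G) : (forall i, deg (F i) = 0) ->
  (\prod_(i <- r) F i)%g = \sum_(i <- r) (F i : A).
Proof.
move=> F0; elim: r => [|i r IH]; first by rewrite !big_nil.
by rewrite !big_cons mulg_deg0 // IH.
Qed.

Lemma zprod_deg0 n x z c : deg x = 1 -> deg z = 0 ->
  zprod n (x : G) (z : G) c = \sum_(i < n) (iter i psi z : A) *~ c i.
Proof.
move=> x1 z0; rewrite /zprod prodg_deg0 => [|i].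
  by apply: eq_bigr => i _; rewrite zexpg_deg0 ?degJ // conjg_deg1.
by rewrite deg_zexpg degJ z0 mul0r.
Qed.

End CyclicBrace.

Arguments deg [A psi s] s_psi g.

(** * The cyclically permuted basis *)

Section PermutedBasis.
Variables (n : nat) (n_gt1 : (1 < n)%N) (A : zmodType) (x : 'I_n -> A).
Variable psi : zaut A.
Hypothesis psi_x : forall i, psi (x i) = x (ordS i).

Let x1 := x (Ordinal (ltnW n_gt1)).
Let x2 := x (Ordinal n_gt1).

Lemma iter_psi (i : 'I_n) : iter i psi x1 = x i.
Proof.
case: i => i /=; elim: i => [|i IH] i_lt /=; first by congr x; apply: val_inj.
by rewrite (IH (ltnW i_lt)) psi_x; congr x; apply: val_inj; rewrite /= modn_small.
Qed.

Lemma iter_psi_n : iter n psi x1 = x1.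
Proof.
have n1_lt : (n.-1 < n)%N by rewrite ltn_predL ltnW.
rewrite -{1}(ltn_predK n_gt1) iterS (iter_psi (Ordinal n1_lt)) psi_x; congr x.
by apply: val_inj; rewrite /= (ltn_predK n_gt1) modnn.
Qed.

Lemma iter_psi_z i : iter i psi (x2 - x1) = iter i.+1 psi x1 - iter i psi x1.
Proof.
have -> : x2 = psi x1.
  by rewrite psi_x; congr x; apply: val_inj; rewrite /= modn_small.
by elim: i => //= i ->; rewrite raddfB.
Qed.

(** Summation by parts around the cycle: the iterates of [x2 - x1] are differences of consecutive
    basis elements. *)
Lemma sum_iter_psi_z (c : nat -> int) :
  \sum_(i < n) iter i psi (x2 - x1) *~ c i
  = \sum_(i < n) x i *~ (cshift n c i - c i).
Proof.
have shift : \sum_(i < n.-1.+1) iter i.+1 psi x1 *~ c i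
           = \sum_(i < n.-1.+1) iter i psi x1 *~ cshift n c i.
  rewrite big_ord_recr big_ord_recl addrC; congr (_ + _).
  by rewrite /= -iterS (ltn_predK n_gt1) iter_psi_n.
rewrite (ltn_predK n_gt1) in shift.
under eq_bigr do rewrite iter_psi_z mulrzBl.
rewrite sumrB shift -sumrB.
by apply: eq_bigr => i _; rewrite -mulrzBr iter_psi.
Qed.

Lemma psi_degree (s : {additive A -> int}) :
  free_basis x -> (forall i, s (x i) = 1) -> forall a, s (psi a) = s a.
Proof.
move=> hx s_x a; have [c [-> _]] := hx a; rewrite !raddf_sum.
by apply: eq_bigr => i _; rewrite !raddfMz /= psi_x !s_x.
Qed.

End PermutedBasis.

(** Negated partial sums solve the cyclic difference equation; the wrap-around at index 0 is
    consistent because the full sum vanishes. *)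
Lemma sum_cshift_solution n (d : 'I_n -> int) : \sum_(i < n) d i = 0 ->
  exists c : nat -> int, forall i : 'I_n, cshift n c i - c i = d i.
Proof.
move=> d0; exists (fun i => - \sum_(j < n | (j <= i)%N) d j) => -[[|i] i_lt] /=.
  rewrite (eq_bigl xpredT) => [|j]; last by rewrite -ltnS (ltn_predK i_lt) ltn_ord.
  rewrite d0 oppr0 sub0r opprK (big_pred1 (Ordinal i_lt)) // => j.
  by rewrite leqn0 /= -val_eqE.
rewrite opprK addrC [X in X - _](bigD1 (Ordinal i_lt)) //= -addrA.
rewrite [X in _ + (X - _)](eq_bigl (fun j : 'I_n => (j <= i)%N)) ?subrr ?addr0 //.
by move=> j; rewrite -val_eqE /=; lia.
Qed.

(** The kernel of the cyclic difference operator consists of constants, which are exponents that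
    [zprod_const] kills. *)
Lemma cshift_const n c : (forall i, (i < n)%N -> cshift n c i = c i) ->
  forall i, (i < n)%N -> c i = c 0%N.
Proof.
move=> cE; elim=> // i IH i_lt.
by rewrite -(cE _ i_lt) /= IH // ltnW.
Qed.

(** * From relations between words to the presentation of the circle group *)

Lemma cyclic_relsP n (G : groupType) (gen : bool -> G) :
  (forall r, cyclic_relations n r -> free_lift gen r.1 = free_lift gen r.2) <->
  cyclic_rels n (gen false) (gen true).
Proof.
have lx : free_lift gen fx = gen false := free_lift_gen gen false.
have lz : free_lift gen fz = gen true := free_lift_gen gen true.
split=> [H|[rel1 rel2 rel3] r [[->|->]|[k /= /rel3 rel <-]]] /=.
- split=> [||k k_le].
  + by have /= := H _ (or_introl (or_introl erefl));
      rewrite gmulfR gmulfXn gmulf1 /= lx lz.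
  + by have /= := H _ (or_introl (or_intror erefl));
      rewrite !gmulfXn gmulfM /= lx lz.
  + have /= := H _ (or_intror (ex_intro2 _ _ k k_le erefl)).
    by rewrite !gmulfR gmulfXn gmulf1 /= lx lz.
- by rewrite gmulfR gmulfXn gmulf1 /= lx lz.
- by rewrite !gmulfXn gmulfM /= lx lz.
- by rewrite !gmulfR gmulfXn gmulf1 /= lx lz.
Qed.

Theorem theorem4p7 (n : nat) (hn : (2 <= n)%N) (A : zmodType)
    (x : 'I_n -> A) (hx : free_basis x)
    (psi : zaut A) (hpsi : forall i : 'I_n, psi (x i) = x (ordS i))
    (circ : A -> A -> A)
    (hcirc : forall (alpha : {ffun 'I_n -> int}) (b : A),
      let a := \sum_(i < n) x i *~ alpha i in
      circ a b = a + (zexpg psi (\sum_(i < n) alpha i) : zaut A) b) :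
  let x1 := x (Ordinal (ltnW hn)) in
  let x2 := x (Ordinal hn) in
  exists B : brace A,
    [/\ forall a b : A, bop B a b = circ a b,
        lambda_cyclic B
      & presentation (gen_xz (x1 : circ_group B) (x2 - x1 : A))
          (cyclic_relations n)].
Proof.
move=> x1 x2; have [s sE] := free_basis_degree hx.
have s_x i : s (x i) = 1.
  have /= := sE (fun j => if j == i then 1 else 0).
  rewrite (bigD1 i) //= eqxx big1 => [|j /negPf->]; last exact: mulr0z.
  rewrite addr0 => ->; rewrite (bigD1 i) //= eqxx big1 ?addr0 // => j.
  by move=> /negPf->.
have s_psi := psi_degree hpsi hx s_x.
exists (cyc_brace s_psi); split.
- move=> a b; have [c [-> _]] := hx a.
  by rewrite hcirc /= /cyc_op sE.
- exact: (cyc_brace_lambda_cyclic s_psi (s_x (Ordinal hn))).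
set G := circ_group _; pose z : G := x2 - x1.
have x_deg : deg s_psi x1 = 1 by rewrite /deg s_x.
have z_deg : deg s_psi z = 0 by rewrite /deg raddfB !s_x subrr.
have zprodE c : zprod n (x1 : G) z c = \sum_(i < n) x i *~ (cshift n c i - c i).
  by rewrite zprod_deg0 // sum_iter_psi_z.
have relsG : cyclic_rels n (x1 : G) z.
  split=> [||k _].
  (* Conjugation by [x1 ^- n] acts on [z] as the [n]-th iterate of [psi], which fixes [z]. *)
  - apply/eqP/commgP/commute_sym; rewrite -[((x1 : G) ^+ n)%g]invgK.
    apply/commuteV/commgP/conjg_fixP; rewrite conjg_deg1 // iter_psi_z // iterS.
    by rewrite iter_psi_n // -(iter_psi_z hn hpsi 0).
  (* The product of the conjugates has all exponents equal to 1, so its cyclic differences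
     vanish. *)
  - rewrite expg_zx; suff -> : (\prod_(i < n) z ^ (x1 : G) ^- i)%g = 1%g.
      by rewrite mul1g.
    transitivity (zprod n (x1 : G) z (fun=> 1)) => //.
    by rewrite zprodE big1 // => -[[|i] i_lt] _; rewrite subrr mulr0z.
  (* The commutator of [z] and [x1 ^+ k] has degree 0, as has [z], and elements of degree 0
     commute. *)
  - apply/eqP/commgP/commute_deg0 => //.
    by rewrite commgEl degM degV degJ addNr.
apply: presentationP.
(* Dividing by the power of [x1] of the same degree leaves an element of coordinate sum 0, which the
   conjugates of [z] generate. *)
- move=> a; pose m := deg s_psi a; pose b : G := (a * zexpg (x1 : G) (- m))%g.
  have b_deg : deg s_psi b = 0 by rewrite degM deg_zexpg x_deg mul1r subrr.
  have [d [bE _]] := hx b.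
  have [c cE] : exists c : nat -> int, forall i : 'I_n, cshift n c i - c i = d i.
    by apply: sum_cshift_solution; rewrite -sE -bE.
  exists (zprod n fx fz c * zexpg fx m)%g.
  rewrite gmulfM gmulf_zprod gmulf_zexpg /= !free_lift_gen /= zprodE.
  under eq_bigr do rewrite cE.
  by rewrite -bE /b -mulgA -zexpgD addNr mulg1.
- by apply/cyclic_relsP.
- move=> Q gen /cyclic_relsP relsQ w.
  (* The same [c] and [m] serve in the brace and in [Q]. In the brace, the degree forces [m = 0] and
     freeness of the basis makes [c] constant, so the word dies in [Q]. *)
  have [c [m E]] := word_normal_form hn w.
  have genE : gen = gen_xz (gen false) (gen true) by apply: funext => -[].
  rewrite genE /free_lift (E _ _ _ relsG) (E _ _ _ relsQ) => w1.
  have m0 : m = 0.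
    have := congr1 (deg s_psi) w1.
    by rewrite degM deg_zprod // deg_zexpg x_deg add0r mul1r deg1.
  move: w1; rewrite m0 !mulg1 zprodE => c0.
  have c_shift : (fun i : 'I_n => cshift n c i - c i) =1 (fun=> 0).
    apply: (free_basis_inj hx); rewrite c0 big1 // => i _; exact: mulr0z.
  have c_const i : (i < n)%N -> c i = c 0%N.
    apply: cshift_const => j j_lt; apply/eqP; rewrite -subr_eq0.
    exact/eqP/(c_shift (Ordinal j_lt)).
  by rewrite (zprod_ext _ _ c_const) zprod_const.
Qed.
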